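(* Let $\mathbf P=(P,\leq)$ be a partially ordered set with maximum $1$ and let $a \in P$. The following conditions are equivalent. (1) The element $a$ is a non-generator. (2) Both (i) $a \leq p$ for every maximal$_{<1}$ element $p$ of $\mathbf P$, and (ii) for every $e \in P$ such that $e<1$ and $e$ cannot be extended to a maximal$_{<1}$ element, there is $r \in P$ such that $r<1$, $a<r$ and $e<r$. (3) Both (i) $a \leq p$ for every maximal$_{<1}$ element $p$ of $\mathbf P$, and (iii) for every unbounded$_{<1}$ chain $(e_i)_{i\in I}$ in $\mathbf P$ and for every $i \in I$, there is $r \in P$ such that $r<1$, $a \leq r$ and $e_i \leq r$. (4) Both (i) $a \leq p$ for every maximal$_{<1}$ element $p$ of $\mathbf P$, and (iv) whenever $(e_i)_{i \in I}$ is an unbounded$_{<1}$ chain in $\mathbf P$ such that no element of the chain can be extended to a maximal$_{<1}$ element, then for every $i\in I$ there is $r \in P$ such that $r<1$, $a \leq r$ and $e_i \leq r$. Moreover, in (iii) and in (iv) ''for every $i \in I$'' can be equivalently replaced by ''for some $i \in I$'' (that is, the equivalence of all the conditions remains true with this replacement).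
   Context: Let $\mathbf P=(P,\leq)$ be a poset with maximum $1$ (not assumed to be a semilattice). For $a,e \in P$, ''$a \vee e = 1$'' means that there is no $p \in P$ such that $p<1$, $a \leq p$ and $e \leq p$. An element $a\in P$ is a non-generator if, for every $e \in P$, $a\vee e=1$ implies $e=1$. An element $p\in P$ is maximal$_{<1}$ if $p<1$ and there is no $q \in P$ such that $p<q<1$. An element $e\in P$ can be extended to a maximal$_{<1}$ element if there is a maximal$_{<1}$ element $p$ with $e \leq p$. A chain is a nonempty subset that is linearly ordered by the induced order; chains are denoted as families $(e_i)_{i\in I}$. A chain $(e_i)_{i \in I}$ in $\mathbf P$ is unbounded$_{<1}$ if $e_i<1$ for every $i\in I$ and there is no $p\in P$ such that $p<1$ and $e_i\leq p$ for every $i \in I$. *)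

(* Defs.v *)
From mathcomp Require Import all_boot all_order.
From mathcomp Require Import boolp classical_sets.

Set Implicit Arguments.
Unset Strict Implicit.
Unset Printing Implicit Defensive.

Import Order.TTheory.

Local Open Scope classical_set_scope.
Local Open Scope order_scope.

Section PosetWithMaximum.
Context {d : Order.disp_t} {P : tPOrderType d}.
Implicit Types (a e p : P) (C : set P).

(* "a \/ e = 1"; P need not be a semilattice, so this is not an equation
   between elements of P. *)
Definition join_is_top a e : Prop :=
  ~ exists p, [/\ p < \top, a <= p & e <= p].

Definition nongenerator a : Prop :=
  forall e, join_is_top a e -> e = \top.

Definition maximal_lt1 p : Prop :=
  p < \top /\ ~ exists q : P, p < q < \top.

Definition extends_to_maximal_lt1 e : Prop :=
  exists2 p, maximal_lt1 p & e <= p.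

(* A chain is represented by the set of its members; it is nonempty by
   convention. *)
Definition chain C : Prop := C !=set0 /\ total_on C <=%O.

Definition unbounded_lt1 C : Prop :=
  (forall e, C e -> e < \top) /\
  ~ exists p, p < \top /\ forall e, C e -> e <= p.

End PosetWithMaximum.

(* Main.v *)
(* The only nontrivial step is from the last condition back to the first: if
   [e < \top] does not extend to a maximal element, then by Zorn's lemma some
   chain of elements [x] with [e <= x < \top] is unbounded. None of these [x]
   extends to a maximal element either, so one of them has a common bound
   [r < \top] with [a], and [e <= x <= r]. *)
Require Import Defs.
From mathcomp Require Import all_boot all_order.
From mathcomp Require Import boolp classical_sets.

Import Order.TTheory.
Local Open Scope classical_set_scope.
Local Open Scope order_scope.

Section NonGenerators.
Context {d : Order.disp_t} {P : tPOrderType d}.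
Implicit Types (a e p : P) (C : set P).

(** Classical contraposition turns the definition into the existence of a common bound below [\top],
    the form in which the other conditions are phrased. *)
Lemma nongeneratorP a :
  nongenerator a <->
  forall e, e < \top -> exists r, [/\ r < \top, a <= r & e <= r].
Proof.
split=> [nga e lte|H e je].
  apply: contrapT => nex.
  by rewrite (nga e nex) ltxx in lte.
apply: contrapT => /eqP ne; apply: je; apply: H.
by rewrite lt_neqAle ne lex1.
Qed.

Lemma extends_to_maximal_lt1_le e p :
  e <= p -> extends_to_maximal_lt1 p -> extends_to_maximal_lt1 e.
Proof. by move=> lep [q maxq lepq]; exists q => //; apply: le_trans lepq. Qed.

(** Zorn's lemma is applied to the interval [T] of all [x] with [e <= x < \top]: if every chain in
    it were bounded below [\top], it would have a maximal element, to which [e] would extend. *)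
Lemma unbounded_chain_above e :
  e < \top -> ~ extends_to_maximal_lt1 e ->
  exists C, [/\ chain C, unbounded_lt1 C & forall x, C x -> e <= x].
Proof.
move=> lte nexte; apply: contrapT => noC; apply: nexte.
pose T := {x : P | e <= x < \top}.
have ee : e <= e < \top by rewrite lexx lte.
have [|||A totA|[p pP] maxp] := @Zorn T (fun s t => sval s <= sval t).
- by move=> s; apply: lexx.
- by move=> r s t; apply: le_trans.
- by move=> s t st ts; apply: val_inj; apply/eqP; rewrite eq_le st.
(* Zorn's lemma also asks for a bound of the empty chain, here [e] itself. *)
- have [[s As]|A0] := pselect (A !=set0); last first.
    by exists (exist _ e ee) => s As; case: A0; exists s.
  apply: contrapT => noub; apply: noC.
  exists [set sval t | t in A]; split.
  + split; first by exists (sval s), s.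
    by move=> _ _ [t At <-] [u Au <-]; apply: totA.
  + split=> [_ [t _ <-]|[p [ltp ubp]]]; first by case/andP: (svalP t).
    (* A bound in [P] lies above the member [s], hence above [e], so it belongs to [T]. *)
    have ep : e <= p.
      by have /andP[es _] := svalP s; apply: le_trans es _; apply: ubp; exists s.
    have pP : e <= p < \top by rewrite ep.
    by apply: noub; exists (exist _ p pP) => t At; apply: ubp; exists t.
  + by move=> _ [t _ <-]; case/andP: (svalP t).
- have /andP[ep ltp] := pP.
  (* Maximality in [T] is maximality in [P] below [\top], since any [q] with [p < q < \top] is again
     in [T]. *)
  exists p => //; split=> // -[q /andP[pq ltq]].
  have qP : e <= q < \top by rewrite ltq (le_trans ep (ltW pq)).
  have /(congr1 sval)/= qp := maxp (exist _ q qP) (ltW pq).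
  by rewrite qp ltxx in pq.
Qed.

End NonGenerators.

Theorem theorem2p3 (d : Order.disp_t) (P : tPOrderType d) (a : P) :
  [<-> (* (1) *)
       nongenerator a;
       (* (2) *)
       (forall p : P, maximal_lt1 p -> a <= p) /\
       (forall e : P, e < \top -> ~ extends_to_maximal_lt1 e ->
          exists r : P, [/\ r < \top, a < r & e < r]);
       (* (3) *)
       (forall p : P, maximal_lt1 p -> a <= p) /\
       (forall C : set P, chain C -> unbounded_lt1 C ->
          forall e : P, C e ->
            exists r : P, [/\ r < \top, a <= r & e <= r]);
       (* (4) *)
       (forall p : P, maximal_lt1 p -> a <= p) /\
       (forall C : set P, chain C -> unbounded_lt1 C ->
          (forall e : P, C e -> ~ extends_to_maximal_lt1 e) ->
          forall e : P, C e ->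
            exists r : P, [/\ r < \top, a <= r & e <= r]);
       (* (3) with "for some i" *)
       (forall p : P, maximal_lt1 p -> a <= p) /\
       (forall C : set P, chain C -> unbounded_lt1 C ->
          exists2 e : P, C e &
            exists r : P, [/\ r < \top, a <= r & e <= r]);
       (* (4) with "for some i" *)
       (forall p : P, maximal_lt1 p -> a <= p) /\
       (forall C : set P, chain C -> unbounded_lt1 C ->
          (forall e : P, C e -> ~ extends_to_maximal_lt1 e) ->
          exists2 e : P, C e &
            exists r : P, [/\ r < \top, a <= r & e <= r])].
Proof.
tfae.
- move=> /nongeneratorP nga; split=> [p [ltp maxp]|e lte nexte].
    have [r [ltr ar pr]] := nga p ltp.
    have [->//|rp] := eqVneq p r.
    by case: maxp; exists r; rewrite lt_neqAle rp pr.
  have [r [ltr ar er]] := nga e lte.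
  (* Strict bounds are required: any [q] strictly between [r] and [\top] gives them, and without
     such a [q] the element [r] is maximal and extends [e]. *)
  have [[q /andP[rq ltq]]|nq] := pselect (exists q, r < q < \top).
    by exists q; split=> //; apply: le_lt_trans rq.
  by case: nexte; exists r.
- case=> Hmax Hext; split=> // C chC [ltC _] e Ce.
  have [[p maxp ep]|nexte] := pselect (extends_to_maximal_lt1 e).
    by exists p; split=> //; [case: maxp|apply: Hmax].
  have [r [ltr ar er]] := Hext e (ltC e Ce) nexte.
  by exists r; split=> //; apply: ltW.
- by case=> Hmax HC; split=> // C chC unbC _; apply: HC.
- case=> Hmax HC; split=> // C chC unbC.
  (* A single extendable member suffices, its maximal extension being above [a]; otherwise the
     hypothesis applies to the whole chain. *)
  have [[e Ce [p maxp ep]]|nextC] :=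
    pselect (exists2 e, C e & extends_to_maximal_lt1 e).
    by exists e => //; exists p; split=> //; [case: maxp|apply: Hmax].
  have [[e Ce] _] := chC.
  exists e => //; apply: (HC C) => // x Cx extx.
  by apply: nextC; exists x.
- by case=> Hmax HC; split=> // C chC unbC _; apply: HC.
- case=> Hmax HC; apply/nongeneratorP => e lte.
  have [[p maxp ep]|nexte] := pselect (extends_to_maximal_lt1 e).
    by exists p; split=> //; [case: maxp|apply: Hmax].
  have [C [chC unbC geC]] := unbounded_chain_above _ lte nexte.
  have [|x Cx [r [ltr ar xr]]] := HC C chC unbC.
    by move=> x /geC ex /(extends_to_maximal_lt1_le _ _ ex).
  by exists r; split=> //; apply: le_trans (geC x Cx) xr.
Qed.
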